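(* Let $N:\mathcal{A}\to\mathcal{A}$ be a Nijenhuis operator on an associative conformal algebra $\mathcal{A}$. Then $$\omega_\lambda(a,b)=N(a)_\lambda b+a_\lambda N(b)-N(a_\lambda b),\qquad a,b\in\mathcal{A},$$ generates a deformation of $\mathcal{A}$, and this deformation is trivial.
   Context: All vector spaces are over $\mathbb{C}$. A conformal bilinear map on a $\mathbb{C}[\partial]$-module $\mathcal{A}$ is a $\mathbb{C}$-bilinear map $\omega_\lambda:\mathcal{A}\times\mathcal{A}\to\mathcal{A}[\lambda]$ with $\omega_\lambda(\partial a,b)=-\lambda\,\omega_\lambda(a,b)$ and $\omega_\lambda(a,\partial b)=(\partial+\lambda)\omega_\lambda(a,b)$. An associative conformal algebra is a $\mathbb{C}[\partial]$-module $\mathcal{A}$ with a conformal bilinear map $(a,b)\mapsto a_\lambda b$ satisfying $(a_\lambda b)_{\lambda+\mu}c=a_\lambda(b_\mu c)$ for all $a,b,c\in\mathcal{A}$. Maps are extended coefficientwise to polynomials. A Nijenhuis operator on $\mathcal{A}$ is a $\mathbb{C}[\partial]$-module homomorphism $N:\mathcal{A}\to\mathcal{A}$ with $N(a)_\lambda N(b)=N\big(N(a)_\lambda b+a_\lambda N(b)-N(a_\lambda b)\big)$ for all $a,b\in\mathcal{A}$. A conformal bilinear map $\omega_\lambda:\mathcal{A}\times\mathcal{A}\to\mathcal{A}[\lambda]$ generates a deformation of $\mathcal{A}$ if for every value of the parameter $t$ the $\lambda$-multiplication $a\circ^t_\lambda b=a_\lambda b+t\,\omega_\lambda(a,b)$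 makes $\mathcal{A}$ an associative conformal algebra. The deformation is trivial if there is a $\mathbb{C}[\partial]$-module homomorphism $N':\mathcal{A}\to\mathcal{A}$ such that for $T_t=\mathrm{id}+tN'$ one has $T_t(a\circ^t_\lambda b)=T_t(a)_\lambda T_t(b)$ for all $a,b\in\mathcal{A}$ and all $t$. *)

(* Defs.v *)
From HB Require Import structures.
From mathcomp Require Import all_boot all_order all_algebra.
From mathcomp Require Import reals complex.
From mathcomp Require Import finmap monalg.

Set Implicit Arguments.
Unset Strict Implicit.
Unset Printing Implicit Defensive.

Import GRing.Theory.
Local Open Scope ring_scope.

(* A K[d]-module is an lmodType over {poly K}: d acts as scaling by 'X and a
   scalar c : K as scaling by c%:P; its endomorphisms are {linear A -> A}.
   lpoly A is A[lambda]: p@_n is the coefficient of lambda^n. The alias over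
   malg carries the coefficientwise K[d]-module structure. *)
Definition lpoly (A : zmodType) : Type := {malg A[nat]}.

(* A[lambda, mu]: p@_(i, j) is the coefficient of lambda^i mu^j. *)
Definition lpoly2 (A : zmodType) : Type := {malg A[(nat * nat)%type]}.

HB.instance Definition _ (A : zmodType) := GRing.Zmodule.on (lpoly A).
HB.instance Definition _ (A : zmodType) :=
  GRing.Zmodule.on (lpoly2 A).

Definition map_lpoly (A B : zmodType) (f : A -> B) (p : lpoly A) : lpoly B :=
  \sum_(n <- msupp p) << f p@_n *g n >>.

Definition mul_lambda (A : zmodType) (p : lpoly A) : lpoly A :=
  \sum_(n <- msupp p) << p@_n *g n.+1 >>.

Lemma map_lpolyE (A B : zmodType) (f : A -> B) (p : lpoly A) (n : nat) :
  f 0 = 0 -> mcoeff n (map_lpoly f p) = f (mcoeff n p).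
Proof.
move=> f0; rewrite /map_lpoly raddf_sum /=.
case: (msuppP p n) => [pn|pn].
  rewrite (big_fsetD1 n) //= mcoeffUU big1_fset ?addr0 // => k.
  by rewrite in_fsetD1 mcoeffU; case: eqP.
rewrite f0 big1_fset // => k kp _.
by rewrite mcoeffU; case: eqP kp pn => // -> ->.
Qed.

Section LpolyModule.
Variables (S : nzRingType) (A : lmodType S).

Definition lpoly_scale (c : S) (p : lpoly A) : lpoly A :=
  map_lpoly (fun a => c *: a) p.

Lemma lpoly_scaleE c p n : mcoeff n (lpoly_scale c p) = c *: mcoeff n p.
Proof. by rewrite map_lpolyE ?scaler0. Qed.

Lemma lpoly_scaleA c d p :
  lpoly_scale c (lpoly_scale d p) = lpoly_scale (c * d) p.
Proof. by apply/malgP => n; rewrite !lpoly_scaleE scalerA. Qed.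

Lemma lpoly_scale1 : left_id 1 lpoly_scale.
Proof. by move=> p; apply/malgP => n; rewrite lpoly_scaleE scale1r. Qed.

Lemma lpoly_scaleDr : right_distributive lpoly_scale +%R.
Proof.
by move=> c p q; apply/malgP => n; rewrite mcoeffD !lpoly_scaleE mcoeffD scalerDr.
Qed.

Lemma lpoly_scaleDl p : {morph lpoly_scale^~ p : c d / c + d}.
Proof.
by move=> c d; apply/malgP => n; rewrite mcoeffD !lpoly_scaleE scalerDl.
Qed.

HB.instance Definition _ := GRing.Zmodule_isLmodule.Build S (lpoly A)
  lpoly_scaleA lpoly_scale1 lpoly_scaleDr lpoly_scaleDl.

End LpolyModule.

Section Conformal.
Variables (K : comNzRingType) (A : lmodType {poly K}).
Implicit Types (w m : A -> A -> lpoly A) (N : {linear A -> A}).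

Definition conformal_bilinear w : Prop :=
  [/\ forall (c : K) (a a' b : A),
        w (c%:P *: a + a') b = c%:P *: w a b + w a' b,
      forall (c : K) (a b b' : A),
        w a (c%:P *: b + b') = c%:P *: w a b + w a b',
      forall a b : A, w ('X *: a) b = - mul_lambda (w a b)
    & forall a b : A, w a ('X *: b) = 'X *: w a b + mul_lambda (w a b)].

(* a_lambda p(mu) *)
Definition conf_mulr m (a : A) (p : lpoly A) : lpoly2 A :=
  \sum_(n <- msupp p) \sum_(k <- msupp (m a p@_n))
    << (m a p@_n)@_k *g (k, n) >>.

(* p(lambda)_{lambda + mu} c, where (lambda + mu)^k is expanded by the
   binomial theorem *)
Definition conf_mull m (p : lpoly A) (c : A) : lpoly2 A :=
  \sum_(n <- msupp p) \sum_(k <- msupp (m p@_n c)) \sum_(i < k.+1)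
    << (m p@_n c)@_k *+ 'C(k, i) *g ((n + i)%N, (k - i)%N) >>.

Definition assoc_conformal m : Prop :=
  conformal_bilinear m /\
  forall a b c : A, conf_mull m (m a b) c = conf_mulr m a (m b c).

Definition nijenhuis m N : Prop :=
  forall a b : A,
    m (N a) (N b) = map_lpoly N (m (N a) b + m a (N b) - map_lpoly N (m a b)).

Definition deformed m w (t : K) (a b : A) : lpoly A :=
  m a b + t%:P *: w a b.

Definition generates_deformation m w : Prop :=
  conformal_bilinear w /\ forall t : K, assoc_conformal (deformed m w t).

Definition trivial_deformation m w : Prop :=
  exists N' : {linear A -> A},
    let T (t : K) (a : A) := a + t%:P *: N' a in
    forall (t : K) (a b : A),
      map_lpoly (T t) (deformed m w t a b) = m (T t a) (T t b).

End Conformal.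

(* Main.v *)
(** Write [L f p c] and [R f a p] for the two sides of the associativity
    identity, as functions of a product [f], taken coefficientwise.
    With [w] the Nijenhuis product,
      L m (w a b) c + L w (m a b) c
        = L m (m (N a) b) c + L m (m a (N b)) c + L m (m a b) (N c)
          - N (L m (m a b) c),
    and the mirror identity holds for [R], so the terms of degree one in [t]
    cancel.  Since N (w a b) = m (N a) (N b),
      L w (w a b) c
        = L m (m (N a) (N b)) c + L m (m (N a) b) (N c) + L m (m a (N b)) (N c)
          - N (L m (w a b) c + L w (m a b) c),
    so the terms of degree two cancel because those of degree one do.  The
    deformation is trivialised by id + t N. *)
Require Import Defs.
From mathcomp Require Import all_boot all_order all_algebra.
From mathcomp Require Import reals complex.
From mathcomp Require Import finmap monalg.

Set Implicit Arguments.
Unset Strict Implicit.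
Unset Printing Implicit Defensive.

Import GRing.Theory.
Local Open Scope ring_scope.

(** * Finite sums over supports and extraction of coefficients *)

Lemma sum_seq_ord (V : nmodType) (s : seq nat) (n : nat) (F : nat -> V) :
  uniq s -> (forall i, i \notin s -> F i = 0) ->
  \sum_(i <- s | (i < n)%N) F i = \sum_(i < n) F i.
Proof.
move=> s_uniq F0; rewrite -(big_mkord predT) /index_iota subn0 /=.
rewrite [RHS](bigID (mem s)) /= [X in _ + X]big1 => [|i /F0 //].
rewrite addr0 -big_filter -[RHS]big_filter; apply/perm_big/uniq_perm.
- exact: filter_uniq.
- by rewrite filter_uniq ?iota_uniq.
- by move=> i; rewrite !mem_filter mem_iota andbC.
Qed.

Section Coefficients.
Variable A : zmodType.
Implicit Types p : lpoly A.

Lemma mcoeff_mul_lambda p n :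
  (mul_lambda p)@_n = if n is k.+1 then p@_k else 0.
Proof.
rewrite /mul_lambda raddf_sum /=; case: n => [|n].
  by rewrite big1 // => i _; rewrite mcoeffU.
case: (msuppP p n) => [pn|pn].
  rewrite (big_fsetD1 n) //= mcoeffUU big1_fset ?addr0 // => k.
  by rewrite in_fsetD1 mcoeffU eqSS; case: eqP.
rewrite big1_fset // => k kp _.
by rewrite mcoeffU eqSS; case: eqP kp pn => // -> ->.
Qed.

Lemma sum_msupp_eq p n (g : A -> A) : g 0 = 0 ->
  \sum_(k <- msupp p) g p@_k *+ (k == n) = g p@_n.
Proof.
move=> g0; case: (msuppP p n) => [pn|pn].
  rewrite (big_fsetD1 n) //= eqxx big1_fset ?addr0 // => k.
  by rewrite in_fsetD1; case: eqP.
rewrite g0 big1_fset // => k kp _.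
by case: eqP kp pn => // -> ->.
Qed.

End Coefficients.

(** * Coefficients of the two sides of associativity *)

Section Sides.
Variables (A : zmodType) (x y : nat).
Implicit Types (f : A -> A -> lpoly A) (p : lpoly A).

(** This is the coefficient of lambda^x mu^y in p(lambda)_{lambda + mu} c. The term lambda^n of [p]
    leaves lambda^(x - n) mu^y to be taken from (lambda + mu)^(x - n + y), whence the binomial. The
    range n <= x does not depend on [p], which makes additivity in [p] a termwise matter. *)
Definition lside f p c : A :=
  \sum_(n < x.+1) (f p@_(n : nat) c)@_(x - n + y)%N *+ 'C(x - n + y, x - n).

Definition rside f a p : A := (f a p@_y)@_x.

End Sides.

Section Module.
Variables (K : comNzRingType) (A : lmodType {poly K}).
Implicit Types (f g m : A -> A -> lpoly A) (p q : lpoly A).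
Implicit Types N : {linear A -> A}.

Lemma mcoeff_map N p n : (map_lpoly N p)@_n = N p@_n.
Proof. by rewrite map_lpolyE ?linear0. Qed.

Lemma mcoeffZ_lpoly (c : {poly K}) p n : (c *: p)@_n = c *: p@_n.
Proof. exact: lpoly_scaleE. Qed.

Definition lpolyE :=
  (@mcoeffD nat A, @mcoeffB nat A, @mcoeffN nat A, mcoeff_map, mcoeffZ_lpoly).

Lemma mcoeff_conf_mulr m a p (x y : nat) :
  m a 0 = 0 -> (conf_mulr m a p)@_(x, y) = rside x y m a p.
Proof.
move=> m0; rewrite /conf_mulr raddf_sum /rside.
rewrite -(@sum_msupp_eq _ p y (fun u => (m a u)@_x)) ?m0 ?mcoeff0 //.
apply: eq_bigr => n _; rewrite raddf_sum /=.
rewrite -(@sum_msupp_eq _ (m a p@_n) x id) //= -sumrMnl.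
apply: eq_bigr => k _.
by rewrite mcoeffU xpair_eqE -mulrnA mulnb.
Qed.

Lemma mcoeff_conf_mull m p c (x y : nat) :
  m 0 c = 0 -> (conf_mull m p c)@_(x, y) = lside x y m p c.
Proof.
move=> m0; rewrite /conf_mull raddf_sum /=.
set F := fun n : nat => (m p@_n c)@_(x - n + y)%N *+ 'C(x - n + y, x - n).
rewrite /lside -[RHS](@sum_seq_ord _ (msupp p) _ F) ?fset_uniq //; last first.
  by move=> i /mcoeff_outdom pi; rewrite /F pi m0 mcoeff0 mul0rn.
rewrite [RHS]big_mkcond; apply: eq_bigr => n _; rewrite raddf_sum /=.
under eq_bigr do rewrite raddf_sum /=.
(* For n > x the factor lambda^n already exceeds lambda^x, so nothing is contributed. *)
rewrite ltnS; case: leqP => [le_nx|lt_xn]; last first.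
  rewrite big1 // => k _; rewrite big1 // => i _.
  rewrite mcoeffU xpair_eqE; case: eqP => [e|//].
  by move: lt_xn; rewrite -e ltnNge leq_addr.
rewrite /F -(@sum_msupp_eq _ (m p@_n c) (x - n + y)%N
   (fun u => u *+ 'C(x - n + y, x - n))) ?mul0rn //.
apply: eq_bigr => k _.
(* Exactly one pair (i, k) hits the exponents (x, y); the truncated subtraction k - i is harmless
   since i <= k. *)
have E (i : 'I_k.+1) :
    ((n + i, k - i) == (x, y))%N = (i == x - n :> nat)%N && (k == x - n + y)%N.
  rewrite xpair_eqE -{1}(subnKC le_nx) eqn_add2l; case: eqP => //= <-.
  by rewrite -(eqn_add2l i) subnKC // -ltnS.
under eq_bigr do rewrite mcoeffU E.
case: eqP => [->|_]; last by rewrite big1 // => i _; rewrite andbF.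
have lt_x : (x - n < (x - n + y).+1)%N by rewrite ltnS leq_addr.
rewrite (bigD1 (Ordinal lt_x)) //= eqxx big1 ?addr0 // => i.
by rewrite -val_eqE /= => /negPf->.
Qed.

(** * Additivity and scaling of the product and of both sides *)

Section Bilinear.
Variable m : A -> A -> lpoly A.
Hypothesis cm : conformal_bilinear m.

Lemma conf_linearl (c : K) a a' b :
  m (c%:P *: a + a') b = c%:P *: m a b + m a' b.
Proof. by case: cm. Qed.

Lemma conf_linearr (c : K) a b b' :
  m a (c%:P *: b + b') = c%:P *: m a b + m a b'.
Proof. by case: cm. Qed.

Lemma conf_Dl a a' b : m (a + a') b = m a b + m a' b.
Proof. by rewrite -[a]scale1r -[1]/(1%:P) conf_linearl !scale1r. Qed.

Lemma conf_Dr a b b' : m a (b + b') = m a b + m a b'.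
Proof. by rewrite -[b]scale1r -[1]/(1%:P) conf_linearr !scale1r. Qed.

Lemma conf_0l b : m 0 b = 0.
Proof. by apply: (addrI (m 0 b)); rewrite -conf_Dl !addr0. Qed.

Lemma conf_0r a : m a 0 = 0.
Proof. by apply: (addrI (m a 0)); rewrite -conf_Dr !addr0. Qed.

Lemma conf_Zl (c : K) a b : m (c%:P *: a) b = c%:P *: m a b.
Proof. by rewrite -[_ *: a]addr0 conf_linearl conf_0l addr0. Qed.

Lemma conf_Zr (c : K) a b : m a (c%:P *: b) = c%:P *: m a b.
Proof. by rewrite -[_ *: b]addr0 conf_linearr conf_0r addr0. Qed.

Lemma conf_Nl a b : m (- a) b = - m a b.
Proof. by apply: (addrI (m a b)); rewrite -conf_Dl !subrr conf_0l. Qed.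

Lemma conf_Nr a b : m a (- b) = - m a b.
Proof. by apply: (addrI (m a b)); rewrite -conf_Dr !subrr conf_0r. Qed.

Variables x y : nat.

Lemma lsideD p q c : lside x y m (p + q) c = lside x y m p c + lside x y m q c.
Proof.
rewrite -big_split; apply: eq_bigr => n _.
by rewrite mcoeffD conf_Dl mcoeffD mulrnDl.
Qed.

Lemma lsideN p c : lside x y m (- p) c = - lside x y m p c.
Proof.
rewrite -sumrN; apply: eq_bigr => n _.
by rewrite mcoeffN conf_Nl mcoeffN mulNrn.
Qed.

Lemma lsideZ (t : K) p c : lside x y m (t%:P *: p) c = t%:P *: lside x y m p c.
Proof.
rewrite scaler_sumr; apply: eq_bigr => n _.
by rewrite mcoeffZ_lpoly conf_Zl mcoeffZ_lpoly scalerMnr.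
Qed.

Lemma rsideD a p q : rside x y m a (p + q) = rside x y m a p + rside x y m a q.
Proof. by rewrite /rside mcoeffD conf_Dr mcoeffD. Qed.

Lemma rsideN a p : rside x y m a (- p) = - rside x y m a p.
Proof. by rewrite /rside mcoeffN conf_Nr mcoeffN. Qed.

Lemma rsideZ (t : K) a p : rside x y m a (t%:P *: p) = t%:P *: rside x y m a p.
Proof. by rewrite /rside mcoeffZ_lpoly conf_Zr mcoeffZ_lpoly. Qed.

End Bilinear.

Lemma assoc_conformalP m : conformal_bilinear m ->
  assoc_conformal m <->
  forall x y a b c, lside x y m (m a b) c = rside x y m a (m b c).
Proof.
move=> cm; split=> [[_ am] x y a b c|am].
  rewrite -mcoeff_conf_mull ?conf_0l // am.
  by rewrite mcoeff_conf_mulr ?conf_0r.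
split=> // a b c; apply/malgP => -[x y].
rewrite mcoeff_conf_mull ?conf_0l // am.
by rewrite mcoeff_conf_mulr ?conf_0r.
Qed.

(** * Closure properties of conformal bilinear maps *)

Lemma mul_lambdaD p q : mul_lambda (p + q) = mul_lambda p + mul_lambda q.
Proof.
apply/malgP => -[|n]; rewrite mcoeffD !mcoeff_mul_lambda ?addr0 //.
by rewrite mcoeffD.
Qed.

Lemma mul_lambdaN p : mul_lambda (- p) = - mul_lambda p.
Proof.
apply/malgP => -[|n]; rewrite mcoeffN !mcoeff_mul_lambda ?oppr0 //.
by rewrite mcoeffN.
Qed.

Lemma mul_lambda_map N p :
  mul_lambda (map_lpoly N p) = map_lpoly N (mul_lambda p).
Proof.
by apply/malgP => -[|n]; rewrite !(mcoeff_mul_lambda, mcoeff_map) ?linear0.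
Qed.

Lemma mul_lambdaZ (c : {poly K}) p : mul_lambda (c *: p) = c *: mul_lambda p.
Proof.
by apply/malgP => -[|n]; rewrite !(mcoeff_mul_lambda, mcoeffZ_lpoly) ?scaler0.
Qed.

Lemma conformalD f g : conformal_bilinear f -> conformal_bilinear g ->
  conformal_bilinear (fun a b => f a b + g a b).
Proof.
move=> [f1 f2 f3 f4] [g1 g2 g3 g4]; split=> *.
- by rewrite f1 g1 scalerDr addrACA.
- by rewrite f2 g2 scalerDr addrACA.
- by rewrite f3 g3 mul_lambdaD opprD.
- by rewrite f4 g4 mul_lambdaD scalerDr addrACA.
Qed.

Lemma conformalZ (c : {poly K}) f : conformal_bilinear f ->
  conformal_bilinear (fun a b => c *: f a b).
Proof.
move=> [f1 f2 f3 f4]; split=> *.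
- by rewrite f1 scalerDr !scalerA mulrC.
- by rewrite f2 scalerDr !scalerA mulrC.
- by rewrite f3 mul_lambdaZ scalerN.
- by rewrite f4 mul_lambdaZ scalerDr !scalerA mulrC.
Qed.

Lemma conformalN f : conformal_bilinear f ->
  conformal_bilinear (fun a b => - f a b).
Proof.
move=> [f1 f2 f3 f4]; split=> *.
- by rewrite f1 opprD scalerN.
- by rewrite f2 opprD scalerN.
- by rewrite f3 mul_lambdaN.
- by rewrite f4 mul_lambdaN opprD scalerN.
Qed.

(** [N] is linear over {poly K}, so it commutes with the action of 'X as well as with scalars. *)
Lemma conformal_compl N f : conformal_bilinear f ->
  conformal_bilinear (fun a b => f (N a) b).
Proof.
move=> [f1 f2 f3 f4]; split=> *.
- by rewrite linearP f1.
- exact: f2.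
- by rewrite linearZ f3.
- exact: f4.
Qed.

Lemma conformal_compr N f : conformal_bilinear f ->
  conformal_bilinear (fun a b => f a (N b)).
Proof.
move=> [f1 f2 f3 f4]; split=> *.
- exact: f1.
- by rewrite linearP f2.
- exact: f3.
- by rewrite linearZ f4.
Qed.

Lemma map_lpolyD N p q : map_lpoly N (p + q) = map_lpoly N p + map_lpoly N q.
Proof. by apply/malgP => n; rewrite !lpolyE linearD. Qed.

Lemma map_lpolyN N p : map_lpoly N (- p) = - map_lpoly N p.
Proof. by apply/malgP => n; rewrite !lpolyE linearN. Qed.

Lemma map_lpolyZ N (c : {poly K}) p : map_lpoly N (c *: p) = c *: map_lpoly N p.
Proof. by apply/malgP => n; rewrite !lpolyE linearZ. Qed.

Lemma conformal_map N f : conformal_bilinear f ->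
  conformal_bilinear (fun a b => map_lpoly N (f a b)).
Proof.
move=> [f1 f2 f3 f4]; split=> *.
- by rewrite f1 map_lpolyD map_lpolyZ.
- by rewrite f2 map_lpolyD map_lpolyZ.
- by rewrite f3 map_lpolyN mul_lambda_map.
- by rewrite f4 map_lpolyD map_lpolyZ mul_lambda_map.
Qed.

(** * The Nijenhuis product, its deformation and the trivialisation *)

Section Nijenhuis.
Variables (m : A -> A -> lpoly A) (N : {linear A -> A}).
Hypotheses (am : assoc_conformal m) (nN : nijenhuis m N).

Definition nijenhuis_prod a b : lpoly A :=
  m (N a) b + m a (N b) - map_lpoly N (m a b).
Local Notation w := nijenhuis_prod.

Let cm : conformal_bilinear m := proj1 am.

Lemma conformal_nijenhuis_prod : conformal_bilinear w.
Proof.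
apply: conformalD; last exact/conformalN/conformal_map.
exact: conformalD (conformal_compl N cm) (conformal_compr N cm).
Qed.

Let cw := conformal_nijenhuis_prod.

Section Sides.
Variables x y : nat.
Local Notation L := (lside x y).
Local Notation R := (rside x y).

Lemma lside_assoc a b c : L m (m a b) c = R m a (m b c).
Proof. by have /(assoc_conformalP cm) := am; apply. Qed.

Lemma lside_nijenhuis_prod p c :
  L w p c = L m (map_lpoly N p) c + L m p (N c) - N (L m p c).
Proof.
rewrite /lside linear_sum -big_split -sumrB; apply: eq_bigr => n _ /=.
by rewrite !lpolyE mulrnBl mulrnDl [N (_ *+ _)]linearMn.
Qed.

Lemma rside_nijenhuis_prod a p :
  R w a p = R m (N a) p + R m a (map_lpoly N p) - N (R m a p).
Proof. by rewrite /rside !lpolyE. Qed.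

(** The Nijenhuis identity reads m (N u) (N c) = N (w u c); it applies to each coefficient u of [p],
    and [N] then leaves the finite sum. *)
Lemma lside_map p c : L m (map_lpoly N p) (N c) = N (L w p c).
Proof.
rewrite /lside linear_sum; apply: eq_bigr => n _ /=.
by rewrite mcoeff_map nN mcoeff_map linearMn.
Qed.

Lemma rside_map a p : R m (N a) (map_lpoly N p) = N (R w a p).
Proof. by rewrite /rside mcoeff_map nN mcoeff_map. Qed.

Lemma lside_first_order a b c :
  L m (w a b) c + L w (m a b) c =
  L m (m (N a) b) c + L m (m a (N b)) c + L m (m a b) (N c)
    - N (L m (m a b) c).
Proof.
(* The term [L m (map_lpoly N (m a b)) c] occurs once with each sign and cancels. *)
rewrite lside_nijenhuis_prod /nijenhuis_prod !(lsideD cm) (lsideN cm).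
by rewrite !addrA subrK.
Qed.

Lemma rside_first_order a b c :
  R m a (w b c) + R w a (m b c) =
  R m (N a) (m b c) + R m a (m (N b) c) + R m a (m b (N c))
    - N (R m a (m b c)).
Proof.
rewrite rside_nijenhuis_prod /nijenhuis_prod !(rsideD cm) (rsideN cm).
rewrite [LHS]addrC addrACA [- N _ - _]addrC addrA; congr (_ - _).
by rewrite addrAC addrK addrA.
Qed.

(** After the cancellations, the two sides match by associativity of [m] with [N] inserted in one of
    the three slots, and by [N] of plain associativity. *)
Lemma first_order a b c :
  L m (w a b) c + L w (m a b) c = R m a (w b c) + R w a (m b c).
Proof. by rewrite lside_first_order rside_first_order !lside_assoc. Qed.

Lemma lside_second_order a b c :
  L w (w a b) c =
  L m (m (N a) (N b)) c + L m (m (N a) b) (N c) + L m (m a (N b)) (N c)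
    - N (L m (w a b) c + L w (m a b) c).
Proof.
have -> : L w (w a b) c =
    L m (m (N a) (N b)) c + L m (w a b) (N c) - N (L m (w a b) c).
  by rewrite lside_nijenhuis_prod -nN.
have -> : L m (w a b) (N c) =
    L m (m (N a) b) (N c) + L m (m a (N b)) (N c) - N (L w (m a b) c).
  by rewrite !(lsideD cm) (lsideN cm) lside_map.
by rewrite linearD opprD !addrA [LHS]addrAC.
Qed.

Lemma rside_second_order a b c :
  R w a (w b c) =
  R m (N a) (m (N b) c) + R m (N a) (m b (N c)) + R m a (m (N b) (N c))
    - N (R m a (w b c) + R w a (m b c)).
Proof.
have -> : R w a (w b c) =
    R m (N a) (w b c) + R m a (m (N b) (N c)) - N (R m a (w b c)).
  by rewrite rside_nijenhuis_prod -nN.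
have -> : R m (N a) (w b c) =
    R m (N a) (m (N b) c) + R m (N a) (m b (N c)) - N (R w a (m b c)).
  by rewrite !(rsideD cm) (rsideN cm) rside_map.
by rewrite linearD opprD !addrA [_ - _ + _]addrAC [LHS]addrAC.
Qed.

Lemma second_order a b c : L w (w a b) c = R w a (w b c).
Proof.
(* The [N] terms agree by the first-order identity; the rest is associativity of [m] with [N] in two
   slots, up to reordering. *)
rewrite lside_second_order rside_second_order first_order !lside_assoc.
by congr (_ - _); rewrite addrAC -!addrA; congr (_ + _); rewrite addrC.
Qed.

Lemma lside_deformed t p c :
  L (deformed m w t) p c = L m p c + t%:P *: L w p c.
Proof.
rewrite /lside scaler_sumr -big_split; apply: eq_bigr => n _ /=.
by rewrite !lpolyE mulrnDl scalerMnr.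
Qed.

Lemma rside_deformed t a p :
  R (deformed m w t) a p = R m a p + t%:P *: R w a p.
Proof. by rewrite /rside !lpolyE. Qed.

Lemma lside_assoc_deformed t a b c :
  L (deformed m w t) (deformed m w t a b) c =
  R (deformed m w t) a (deformed m w t b c).
Proof.
rewrite lside_deformed rside_deformed.
rewrite (lsideD cm) (lsideD cw) (lsideZ cm) (lsideZ cw).
rewrite (rsideD cm) (rsideD cw) (rsideZ cm) (rsideZ cw).
(* Powers of t are compared: associativity of [m] settles degree 0, [second_order] degree 2, and
   [first_order] the two terms of degree 1. *)
rewrite lside_assoc second_order -!addrA; congr (_ + _).
by rewrite scalerDr addrA -scalerDr first_order scalerDr -addrA -scalerDr.
Qed.

End Sides.

Lemma nijenhuis_generates : generates_deformation m w.
Proof.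
split=> // t.
have cd : conformal_bilinear (deformed m w t).
  exact: conformalD cm (conformalZ _ cw).
by apply/(assoc_conformalP cd) => x y a b c; exact: lside_assoc_deformed.
Qed.

Lemma nijenhuis_trivial : trivial_deformation m w.
Proof.
(* With N' = N, degree 1 in t is the definition of [w], and degree 2 is the Nijenhuis identity. *)
exists N => /= t a b; apply/malgP => n.
rewrite map_lpolyE; last by rewrite linear0 scaler0 addr0.
rewrite /deformed (conf_Dl cm) !(conf_Dr cm) !(conf_Zl cm) !(conf_Zr cm) nN.
rewrite -/(w a b).
have wE : (m a (N b))@_n + (m (N a) b)@_n = (w a b)@_n + N (m a b)@_n.
  by rewrite !lpolyE subrK addrC.
(* Generalising [w a b] keeps the coefficient rules from unfolding it again. *)
move: (w a b) wE => u wE; rewrite !lpolyE linearD linearZ /= !scalerDr !addrA.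
by congr (_ + _); rewrite -!addrA -!scalerDr wE.
Qed.

End Nijenhuis.
End Module.

Theorem theorem5p20 (R : realType) (A : lmodType {poly R[i]})
    (m : A -> A -> lpoly A) (N : {linear A -> A}) :
  assoc_conformal m -> nijenhuis m N ->
  let w (a b : A) : lpoly A := m (N a) b + m a (N b) - map_lpoly N (m a b) in
  generates_deformation m w /\ trivial_deformation m w.
Proof.
by move=> am nN; split; [exact: nijenhuis_generates | exact: nijenhuis_trivial].
Qed.
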